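(* Let $P$ be a spherical polygon on the unit sphere in $\mathbb{R}^3$ centered at $0$, contained in a common hemisphere, with vertices $v_1,\dots,v_n$ ordered anti-clockwise as viewed from outside the sphere and cyclically indexed ($v_{i+n}=v_i$). Let $x$ be an interior point of $P$ with $\langle x,v_i\rangle>0$ for all $i$, and let $Q=[v_1,\dots,v_n,x,-x]$ be the polyhedron bounded by the triangular faces $[x,v_i,v_{i+1}]$ and $[-x,v_i,v_{i+1}]$, $i=1,\dots,n$, such that $0$ lies in the interior of the kernel of $Q$. Let $\phi_1,\dots,\phi_{n+2}$ be the 3D mean value coordinates on $Q$ with respect to its vertices $v_1,\dots,v_n,\ v_{n+1}:=x,\ v_{n+2}:=-x$, and set $$\psi_i(x)=\frac{\phi_i(0)}{\phi_{n+2}(0)-\phi_{n+1}(0)},\qquad i=1,\dots,n.$$ Then $\psi_i(x)$ coincides with the classical spherical mean value coordinate $\lambda_i(x)$ for every $i=1,\dots,n$, that is, $$\psi_i(x)=\lambda_i(x)=\frac{\dfrac{1}{\sin\theta_i}\left(\tan\dfrac{\alpha_i}{2}+\tan\dfrac{\alpha_{i-1}}{2}\right)}{\displaystyle\sum_{j=1}^n\cot\theta_j\left(\tan\dfrac{\alpha_j}{2}+\tan\dfrac{\alpha_{j-1}}{2}\right)} .$$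
   Context: A spherical polygon is defined as a planar polygon except that its edges are geodesics (arcs of great circles) connecting consecutive vertices. The kernel of a polyhedron is the set of points from which the whole polyhedron is visible; here $0$ being in the interior of the kernel of $Q$ means $\langle v_i, v_{i+1}\times x\rangle>0$ for all $i$. $\theta_i$ is the angle between $x$ and $v_i$; $\alpha_i$ is the angle between $x\times v_i$ and $x\times v_{i+1}$ (indices cyclic modulo $n$). The classical spherical mean value coordinates $\lambda_i(x)$ (Langer et al., obtained by gnomonic projection of $P$ to the tangent plane of the sphere at $x$) are those given by the second formula in the claim. 3D mean value coordinates (Floater): for a polyhedron $Q$ with triangular faces and vertices $w_1,\dots,w_m$ and a point $y$ inside the kernel of $Q$, they are $$\phi_i(y)=\frac{\omega_i}{\sum_{l=1}^m\omega_l},\qquad \omega_i=\frac{1}{\|w_i-y\|}\sum_{T\in T(w_i)}\mu_{i,T},$$ where $T(w_i)$ is the set of triangular faces incident to $w_i$ and, for $T=[w_i,w_j,w_k]$ with vertices ordered anti-clockwise as viewed from outside $Q$, $$\mu_{i,T}=\frac{\beta_{jk}+\beta_{ij}\langle n_{ij},n_{jk}\rangle+\beta_{ki}\langle n_{ki},n_{jk}\rangle}{2\langle e_i,n_{jk}\rangle},$$ with $e_r=\dfrac{w_r-y}{\|w_r-y\|}$, $n_{rs}=\dfrac{e_r\times e_s}{\|e_r\times e_s\|}$, and $\beta_{rs}$ the angle between the segments $[y,w_r]$ and $[y,w_s]$. Here these are evaluated at $y=0$. *)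

(* Defs.v *)
From mathcomp Require Import all_boot all_order all_algebra.
From mathcomp Require Import all_classical all_reals all_analysis.

Set Implicit Arguments.
Unset Strict Implicit.
Unset Printing Implicit Defensive.

Import Order.TTheory GRing.Theory Num.Theory.
Import numFieldNormedType.Exports.

Local Open Scope classical_set_scope.
Local Open Scope ring_scope.

(* Vectors of R^3 are rows 'rV[R]_3.  The library norm on rows is the sup
   norm, hence the separate Euclidean norm; the topology is the same. *)
Section Euclid3.
Variable R : realType.
Implicit Types u v : 'rV[R]_3.

Definition dot u v : R := \sum_(k < 3) u 0 k * v 0 k.

Definition enorm u : R := Num.sqrt (dot u u).

(* Indices are taken in Z/3. *)
Definition cross u v : 'rV[R]_3 :=
  \row_(k < 3) (u 0 (k + 1) * v 0 (k + 2) - u 0 (k + 2) * v 0 (k + 1)).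

Definition normalize u : 'rV[R]_3 := (enorm u)^-1 *: u.

(* Unoriented angle, in [0, pi]. *)
Definition vangle u v : R := acos (dot u v / (enorm u * enorm v)).

End Euclid3.

Definition cot (R : realType) (t : R) : R := cos t / sin t.

Section SphericalPolygon.
Variable R : realType.

Definition usphere : set 'rV[R]_3 := [set y | enorm y = 1].

(* For linearly independent unit vectors a and b, the shorter of the two arcs
   of the great circle through a and b. *)
Definition geodesic_arc (a b : 'rV[R]_3) : set 'rV[R]_3 :=
  [set y | usphere y /\
     exists s t : R, [/\ 0 <= s, 0 <= t & y = s *: a + t *: b]].

Variables (n : nat) (v : 'I_n -> 'rV[R]_3).

(* Edge i joins v i to its cyclic successor v (ordS i). *)
Definition edge (i : 'I_n) : set 'rV[R]_3 := geodesic_arc (v i) (v (ordS i)).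

Definition poly_boundary : set 'rV[R]_3 := \bigcup_i edge i.

(* The edges form a simple closed geodesic polygon: the ends of an edge are
   neither equal nor antipodal, and two distinct edges meet at most at a vertex
   that they share as consecutive edges. *)
Definition simple_geodesic_polygon : Prop :=
  [/\ (2 < n)%N,
      forall i, usphere (v i),
      forall i, v (ordS i) <> v i /\ v (ordS i) <> - v i &
      forall i j, i <> j -> forall y, edge i y -> edge j y ->
        (j = ordS i /\ y = v j) \/ (i = ordS j /\ y = v i)].

(* P is the closed region of the sphere on one of the two sides of the curve. *)
Definition spherical_polygon (P : set 'rV[R]_3) : Prop :=
  simple_geodesic_polygon /\
  exists2 y, (usphere `\` poly_boundary) y &
    P = poly_boundary `|` connected_component (usphere `\` poly_boundary) y.

Definition poly_interior (P : set 'rV[R]_3) : set 'rV[R]_3 :=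
  P `\` poly_boundary.

(* The interior lies to the left of every edge for an observer standing outside
   the sphere: from a point of the open edge, the left-hand normal direction is
   v_i x v_{i+1}. *)
Definition anticlockwise (P : set 'rV[R]_3) : Prop :=
  forall (i : 'I_n) (s t : R), 0 < s -> 0 < t ->
    \forall e \near 0^'+,
      poly_interior P (normalize (s *: v i + t *: v (ordS i)
                                  + e *: cross (v i) (v (ordS i)))).

Definition in_common_hemisphere (P : set 'rV[R]_3) : Prop :=
  exists2 h : 'rV[R]_3, usphere h & forall y, P y -> 0 <= dot h y.

End SphericalPolygon.

(* Three-dimensional mean value coordinates.  A polyhedron with triangular
   faces is given by its vertices w : I -> R^3 and the list F of its faces, each
   a triple of vertex labels listed once, anti-clockwise as viewed from outside.
   [oriented_face F i j k] says that [w_i, w_j, w_k], in that cyclic order, is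
   a face; every face incident to w_i is so described by exactly one (j, k). *)
Section MeanValue3D.
Variables (R : realType) (I : finType) (w : I -> 'rV[R]_3).
Variables (F : seq (I * I * I)) (y : 'rV[R]_3).

Definition oriented_face (i j k : I) : bool :=
  [|| (i, j, k) \in F, (j, k, i) \in F | (k, i, j) \in F].

Definition mv_e (r : I) : 'rV[R]_3 := normalize (w r - y).

Definition mv_n (r s : I) : 'rV[R]_3 := normalize (cross (mv_e r) (mv_e s)).

Definition mv_beta (r s : I) : R := vangle (w r - y) (w s - y).

Definition mv_mu (i j k : I) : R :=
  (mv_beta j k + mv_beta i j * dot (mv_n i j) (mv_n j k)
               + mv_beta k i * dot (mv_n k i) (mv_n j k))
  / (2 * dot (mv_e i) (mv_n j k)).

Definition mv_omega (i : I) : R :=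
  (enorm (w i - y))^-1 *
  \sum_(p : I * I | oriented_face i p.1 p.2) mv_mu i p.1 p.2.

Definition mv_phi (i : I) : R := mv_omega i / \sum_(l : I) mv_omega l.

End MeanValue3D.

(* The polyhedron Q = [v_1, ..., v_n, x, -x]: label [inl i] is v_i,
   [inr true] is x and [inr false] is -x. *)
Section Bipyramid.
Variables (R : realType) (n : nat) (v : 'I_n -> 'rV[R]_3) (x : 'rV[R]_3).

Definition bipyramid_vertex (r : 'I_n + bool) : 'rV[R]_3 :=
  match r with
  | inl i => v i
  | inr b => if b then x else - x
  end.

(* The faces at -x are listed in the opposite rotational order to those at x,
   so that all are anti-clockwise as viewed from outside Q. *)
Definition bipyramid_faces :
    seq (('I_n + bool) * ('I_n + bool) * ('I_n + bool)) :=
  [seq (inr true, inl i, inl (ordS i)) | i <- enum 'I_n] ++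
  [seq (inr false, inl (ordS i), inl i) | i <- enum 'I_n].

Definition bipyramid_phi (r : 'I_n + bool) : R :=
  mv_phi bipyramid_vertex bipyramid_faces 0 r.

Definition psi (i : 'I_n) : R :=
  bipyramid_phi (inl i)
  / (bipyramid_phi (inr false) - bipyramid_phi (inr true)).

End Bipyramid.

Section SphericalMeanValue.
Variables (R : realType) (n : nat) (v : 'I_n -> 'rV[R]_3) (x : 'rV[R]_3).

Definition theta (i : 'I_n) : R := vangle x (v i).

Definition alpha (i : 'I_n) : R := vangle (cross x (v i)) (cross x (v (ordS i))).

Definition smv_lambda (i : 'I_n) : R :=
  ((sin (theta i))^-1 * (tan (alpha i / 2) + tan (alpha (ord_pred i) / 2)))
  / \sum_(j < n)
      cot (theta j) * (tan (alpha j / 2) + tan (alpha (ord_pred j) / 2)).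

End SphericalMeanValue.

(* Main.v *)
Require Import Defs.
From mathcomp Require Import all_boot all_order all_algebra.
From mathcomp Require Import all_classical all_reals all_analysis.
From mathcomp Require Import ring lra.

Import Order.TTheory GRing.Theory Num.Theory.
Import numFieldNormedType.Exports.

Local Open Scope classical_set_scope.
Local Open Scope ring_scope.

(** Only the ratios of the weights omega matter for psi, provided that the sum
of all weights is not zero. The vectors x and v_i all have length 1.

At an equatorial vertex a = v_i the faces come in pairs [x, a, b], [-x, b, a]
over a common edge [a, b]. Passing from x to -x replaces the angle between x
and a vertex by its supplement and keeps the normal lines of the side planes,
so the two weights add up to (pi / 2) tan (alpha / 2) / sin theta_i and all
other angles cancel ([face_mu_pair], [face_mu_pair_pred]). Hence omega_i is
pi / 2 times the numerator of lambda_i ([omega_equator]).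

The weights of a face [a, b, c] are built so that
  mu_a a + mu_b b + mu_c c
    = (beta_ab n_ab + beta_bc n_bc + beta_ca n_ca) / 2.
In the component along the apex x only the term of the equatorial edge survives
([face_precision]), and it is the same for [x, a, b] and [-x, b, a]. Subtracting
gives omega_(-x) - omega_x as the sum of omega_j cos theta_j, which is pi / 2
times the denominator of lambda_i ([omega_apex_diff]).

The total weight is positive because the equatorial weights are positive and the
apex weights are nonnegative. The latter amounts to an inequality between the
sides and angles of a spherical triangle: c >= a cos B + b cos A. It follows from
equality in the plane, since the angles of a spherical triangle are at least
those of the Euclidean triangle with the same sides
([spherical_law_of_cosines_le]). *)

(** * Trigonometric inequalities *)

Section Trig.
Set Implicit Arguments.
Unset Strict Implicit.
Unset Printing Implicit Defensive.
Variable R : realType.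
Implicit Types a b c r t : R.

(** Concavity of the sine on [0, pi]: the mean slope of sin over [0, a] is a value
of cos at an earlier point than the mean slope over [a, b]. *)
Lemma sin_over_id_noninc a b : 0 < a -> a <= b -> b <= pi ->
  a * sin b <= b * sin a.
Proof.
move=> a0 ab bpi.
have [|xi1] := @MVT_segment R sin cos 0 a (ltW a0) (fun=> _).
  exact/continuous_subspaceT/continuous_sin.
rewrite sin0 !subr0 in_itv/= => /andP[xi1_0 xi1_a] ea.
have [|xi2] := @MVT_segment R sin cos a b ab (fun=> _).
  exact/continuous_subspaceT/continuous_sin.
rewrite in_itv/= => /andP[xi2_a xi2_b] eb.
have le_cos : cos xi2 <= cos xi1.
  rewrite leNgt ltr_cos ?in_itv/= -?leNgt ?xi1_0 ?(le_trans xi1_a)//=; lra.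
have := ler_wpM2l (mulr_ge0 (ltW a0) (_ : 0 <= b - a)) le_cos.
rewrite subr_ge0 => /(_ ab); nra.
Qed.

(** For t in [0, pi], t ^ 2 is a convex function of cos t, and the left-hand side is
its tangent at cos r. Equivalently t ^ 2 + (2 r / sin r) cos t is minimal at t = r,
because its derivative has the sign of t / sin t - r / sin r. The range extends
beyond pi since sums of two angles are substituted for t. *)
Lemma sqr_ge_cos_tangent r t : 0 < r < pi -> 0 <= t <= pi *+ 2 ->
  r ^+ 2 - 2 * r / sin r * (cos t - cos r) <= t ^+ 2.
Proof.
move=> /andP[r0 rpi] /andP[t0 t2pi].
have s0 : 0 < sin r by rewrite sin_gt0_pi// r0.
set K := 2 * r / sin r.
pose f (s : R) : R := s ^+ 2 + K * cos s.
pose df (s : R) : R := 2 * s - K * sin s.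
have fdf (s : R) : is_derive s 1 f (df s).
  rewrite /f /df; apply: is_derive_eq.
  by rewrite /GRing.scale/=; ring.
have fc (u w : R) : {within `[u, w], continuous f}.
  by apply: derivable_within_continuous => z _; exact: ex_derive.
suff : f r <= f t by rewrite /f mulrBr; lra.
have [rt|tr] := leP r t.
  have [xi] := @MVT_segment R f df r t rt (fun s _ => fdf s) (fc r t).
  rewrite in_itv/= => /andP[xi1 xi2] e.
  rewrite -subr_ge0 e mulr_ge0 ?subr_ge0// /df /K.
  have [xipi|pixi] := leP xi pi.
    have := @sin_over_id_noninc r xi r0 xi1 xipi.
    by rewrite mulrAC ler_pdivrMr//; lra.
  (* beyond pi the sine is nonpositive, so both terms of df are nonnegative *)
  have : 0 <= sin (xi - pi).
    by apply: sin_ge0_pi; apply/andP; split; move: t2pi; rewrite mulr2n; lra.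
  rewrite sinB cospi sinpi => sx.
  have : 0 <= 2 * r / sin r by rewrite divr_ge0 //; lra.
  by move: sx; nra.
have [xi] := @MVT_segment R f df t r (ltW tr) (fun s _ => fdf s) (fc t r).
rewrite in_itv/= => /andP[xi1 xi2] e.
suff : df xi <= 0 by nra.
rewrite /df /K mulrAC subr_le0 ler_pdivlMr//.
have [xi0|xi0] := leP xi 0.
  have -> : xi = 0 by lra.
  by rewrite sin0; lra.
by have := @sin_over_id_noninc xi r xi0 xi2 (ltW rpi); lra.
Qed.

(** Comparison of the spherical law of cosines with the Euclidean one. With b and c
fixed, cos a is affine in the cosine u of the angle A between them, so a ^ 2 is
convex in u; it lies below the chord b ^ 2 + c ^ 2 - 2 b c u, which has the
values (b - c) ^ 2 at u = 1 and (b + c) ^ 2 at u = - 1. *)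
Lemma spherical_law_of_cosines_le a b c : 0 < a < pi -> 0 < b < pi -> 0 < c < pi ->
  `|cos a - cos b * cos c| <= sin b * sin c ->
  2 * b * c * ((cos a - cos b * cos c) / (sin b * sin c))
    <= b ^+ 2 + c ^+ 2 - a ^+ 2.
Proof.
move=> a_ b_ c_ hu.
have sb : 0 < sin b by rewrite sin_gt0_pi.
have sc : 0 < sin c by rewrite sin_gt0_pi.
have sbc : 0 < sin b * sin c by rewrite mulr_gt0.
set u := _ / (sin b * sin c).
have ea : cos a = cos b * cos c + sin b * sin c * u.
  by rewrite /u [_ * (_ / _)]mulrC divfK ?gt_eqF// addrC subrK.
have /andP[u1 u2] : -1 <= u <= 1.
  by rewrite -ler_norml normrM normfV [`|sin b * sin c|]gtr0_norm// ler_pdivrMr// mul1r.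
have := @sqr_ge_cos_tangent a (b + c) a_; have := @sqr_ge_cos_tangent a `|b - c| a_.
have cb : cos `|b - c| = cos (b - c).
  by have [|] := ler0P (b - c) => // _; rewrite cosN.
rewrite cb real_normK ?num_real// cosB cosD ea.
(* the tangent at a, weighted over its values at the two ends of the chord *)
set K := 2 * a / sin a.
move: a_ b_ c_ => /andP[a1 a2] /andP[b1 b2] /andP[c1 c2].
have h1 : 0 <= `|b - c| <= pi *+ 2.
  by rewrite normr_ge0/= ler_norml mulr2n; apply/andP; split; lra.
have h2 : 0 <= b + c <= pi *+ 2 by rewrite mulr2n; apply/andP; split; lra.
move=> /(_ h1) H1 /(_ h2) H2.
have := ler_wpM2l (_ : 0 <= (1 + u) / 2) H1.
have := ler_wpM2l (_ : 0 <= (1 - u) / 2) H2.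
move=> /(_ _)/[swap] /(_ _); lra.
Qed.

(** In the plane the projections of two sides onto the third add up to its length;
on the sphere the angles are larger, so they add up to at most its length. *)
Lemma spherical_projection_le a b c : 0 < a < pi -> 0 < b < pi -> 0 < c < pi ->
  `|cos a - cos b * cos c| <= sin b * sin c ->
  `|cos b - cos a * cos c| <= sin a * sin c ->
  b * ((cos a - cos b * cos c) / (sin b * sin c))
  + a * ((cos b - cos a * cos c) / (sin a * sin c)) <= c.
Proof.
move=> a_ b_ c_ hA hB; have /andP[c0 _] := c_.
have := spherical_law_of_cosines_le a_ b_ c_ hA.
have := spherical_law_of_cosines_le b_ a_ c_ hB.
set Y := _ / (sin a * sin c); set X := _ / (sin b * sin c).
by move=> hY hX; rewrite -(ler_pM2l c0); lra.
Qed.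

Lemma tan_half t : sin t != 0 -> tan (t / 2) = (1 - cos t) / sin t.
Proof.
set s := t / 2; have -> : t = s *+ 2 by rewrite /s mulr2n; lra.
rewrite sin_mulr2n cos_mulr2n /tan => h.
have [s0 c0] : sin s != 0 /\ cos s != 0.
  by split; apply: contra_neq h => ->; rewrite ?(mul0r, mulr0) mul0rn.
have := cos2Dsin2 s => e.
have -> : 1 - (cos s ^+ 2 *+ 2 - 1) = 2 * sin s ^+ 2 by rewrite mulr2n; lra.
by rewrite mulr2n; field; rewrite s0 c0.
Qed.

End Trig.

(** * Vectors and angles in R^3 *)

Section Vectors.
Set Implicit Arguments.
Unset Strict Implicit.
Unset Printing Implicit Defensive.
Variable R : realType.
Implicit Types u v w z : 'rV[R]_3.

Lemma dotE u v : dot u v = u 0 0 * v 0 0 + u 0 1 * v 0 1 + u 0 2 * v 0 2.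
Proof.
rewrite /dot !big_ord_recr big_ord0 /= add0r.
by congr (u 0 _ * v 0 _ + u 0 _ * v 0 _ + u 0 _ * v 0 _); apply: val_inj.
Qed.

Lemma crossE u v :
  ((cross u v 0 0 = u 0 1 * v 0 2 - u 0 2 * v 0 1) *
  (cross u v 0 1 = u 0 2 * v 0 0 - u 0 0 * v 0 2) *
  (cross u v 0 2 = u 0 0 * v 0 1 - u 0 1 * v 0 0))%type.
Proof.
by split; [split|]; rewrite mxE;
  congr (u 0 _ * v 0 _ - u 0 _ * v 0 _); apply: val_inj.
Qed.

Lemma dotC u v : dot u v = dot v u.
Proof. by rewrite !dotE; ring. Qed.

Lemma dotNl u v : dot (- u) v = - dot u v.
Proof. by rewrite !dotE !mxE; ring. Qed.

Lemma dotNr u v : dot u (- v) = - dot u v.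
Proof. by rewrite dotC dotNl dotC. Qed.

Lemma dotZl (k : R) u v : dot (k *: u) v = k * dot u v.
Proof. by rewrite !dotE !mxE; ring. Qed.

Lemma dotZr (k : R) u v : dot u (k *: v) = k * dot u v.
Proof. by rewrite dotC dotZl dotC. Qed.

Lemma crossC u v : cross u v = - cross v u.
Proof. by apply/rowP => k; rewrite !mxE; ring. Qed.

Lemma crossNl u v : cross (- u) v = - cross u v.
Proof. by apply/rowP => k; rewrite !mxE; ring. Qed.

Lemma crossNr u v : cross u (- v) = - cross u v.
Proof. by rewrite crossC crossNl [in RHS]crossC. Qed.

Lemma dot_cross_cross u v w z :
  dot (cross u v) (cross w z) = dot u w * dot v z - dot u z * dot v w.
Proof. by rewrite !dotE !crossE; ring. Qed.

Lemma triple_rot u v w : dot u (cross v w) = dot v (cross w u).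
Proof. by rewrite !dotE !crossE; ring. Qed.

Lemma dot_ge0 u : 0 <= dot u u.
Proof. by rewrite dotE -!expr2 !addr_ge0 ?sqr_ge0. Qed.

Lemma sqr_enorm u : enorm u ^+ 2 = dot u u.
Proof. by rewrite sqr_sqrtr// dot_ge0. Qed.

Lemma enorm_ge0 u : 0 <= enorm u.
Proof. exact: sqrtr_ge0. Qed.

Lemma enormN u : enorm (- u) = enorm u.
Proof. by rewrite /enorm dotNl dotNr opprK. Qed.

Lemma enorm_crossC u v : enorm (cross u v) = enorm (cross v u).
Proof. by rewrite crossC enormN. Qed.

Lemma normalizeN u : normalize (- u) = - normalize u.
Proof. by rewrite /normalize enormN scalerN. Qed.

Lemma normalize_unit u : enorm u = 1 -> normalize u = u.
Proof. by rewrite /normalize => ->; rewrite invr1 scale1r. Qed.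

Lemma vangleC u v : vangle u v = vangle v u.
Proof. by rewrite /vangle dotC [enorm u * _]mulrC. Qed.

Lemma cauchy_schwarz u v : `|dot u v| <= enorm u * enorm v.
Proof.
rewrite -ler_sqr ?nnegrE ?mulr_ge0 ?enorm_ge0//.
rewrite real_normK ?num_real// exprMn !sqr_enorm -subr_ge0.
by have := dot_ge0 (cross u v); rewrite dot_cross_cross [dot v u]dotC expr2.
Qed.

Lemma vangle_itv u v : 0 < enorm u -> 0 < enorm v ->
  -1 <= dot u v / (enorm u * enorm v) <= 1.
Proof.
move=> u0 v0; have uv0 : 0 < enorm u * enorm v by rewrite mulr_gt0.
rewrite -ler_norml normrM normfV [`|enorm u * _|]gtr0_norm//.
by rewrite ler_pdivrMr// mul1r cauchy_schwarz.
Qed.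

Lemma cos_vangle u v : 0 < enorm u -> 0 < enorm v ->
  cos (vangle u v) = dot u v / (enorm u * enorm v).
Proof. by move=> u0 v0; rewrite acosK// in_itv/= vangle_itv. Qed.

Lemma sin_vangle u v : 0 < enorm u -> 0 < enorm v ->
  sin (vangle u v) = enorm (cross u v) / (enorm u * enorm v).
Proof.
move=> u0 v0; rewrite sin_acos ?vangle_itv//.
have uv0 : 0 < enorm u * enorm v by rewrite mulr_gt0.
have -> : 1 - (dot u v / (enorm u * enorm v)) ^+ 2 =
          dot (cross u v) (cross u v) / (enorm u * enorm v) ^+ 2.
  rewrite dot_cross_cross [dot v u]dotC.
  have : dot u u != 0 by rewrite -sqr_enorm expf_neq0// gt_eqF.
  have : dot v v != 0 by rewrite -sqr_enorm expf_neq0// gt_eqF.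
  move=> vn un; rewrite expr_div_n exprMn !sqr_enorm.
  by field; rewrite un vn.
by rewrite sqrtrM ?dot_ge0// sqrtrV ?sqr_ge0// sqrtr_sqr (gtr0_norm uv0).
Qed.

Lemma vangleNl u v : 0 < enorm u -> 0 < enorm v ->
  vangle (- u) v = pi - vangle u v.
Proof.
by move=> u0 v0; rewrite /vangle enormN dotNl mulNr acosN// vangle_itv.
Qed.

Lemma vangleNr u v : 0 < enorm u -> 0 < enorm v ->
  vangle u (- v) = pi - vangle u v.
Proof. by move=> u0 v0; rewrite vangleC vangleNl// vangleC. Qed.

(** Gram determinant of three unit vectors. *)
Lemma sqr_triple u v w : enorm u = 1 -> enorm v = 1 -> enorm w = 1 ->
  dot u (cross v w) ^+ 2 =
  1 - dot u v ^+ 2 - dot v w ^+ 2 - dot w u ^+ 2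
  + 2 * (dot u v * dot v w * dot w u).
Proof.
move=> u1 v1 w1.
have eu : dot u u = 1 by rewrite -sqr_enorm u1 expr1n.
have ev : dot v v = 1 by rewrite -sqr_enorm v1 expr1n.
have ew : dot w w = 1 by rewrite -sqr_enorm w1 expr1n.
have -> : dot u (cross v w) ^+ 2 =
    dot u u * dot v v * dot w w - dot u v ^+ 2 * dot w w
    - dot v w ^+ 2 * dot u u - dot w u ^+ 2 * dot v v
    + 2 * (dot u v * dot v w * dot w u).
  by rewrite !dotE !crossE; ring.
by rewrite eu ev ew; ring.
Qed.

Lemma sqr_enorm_cross u v : enorm u = 1 -> enorm v = 1 ->
  enorm (cross u v) ^+ 2 = 1 - dot u v ^+ 2.
Proof.
move=> u1 v1; rewrite sqr_enorm dot_cross_cross -!sqr_enorm u1 v1 [dot v u]dotC.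
by rewrite expr2; ring.
Qed.

Lemma enorm_cross_gt0 u v w : dot u (cross v w) != 0 -> 0 < enorm (cross v w).
Proof.
apply: contra_neqT; rewrite -leNgt => h.
have h0 : enorm (cross v w) = 0 by apply/le_anti; rewrite h enorm_ge0.
apply/normr0_eq0/le_anti; rewrite normr_ge0 andbT.
by rewrite (le_trans (cauchy_schwarz _ _))// h0 mulr0.
Qed.

(** The double product is a multiple of w by the triple product. *)
Lemma enorm_cross_cross u v w : enorm u = 1 -> enorm v = 1 -> enorm w = 1 ->
  enorm (cross (cross w u) (cross w v)) = `|dot u (cross v w)|.
Proof.
move=> u1 v1 w1; apply/eqP; rewrite -(@eqrXn2 _ 2) ?enorm_ge0//.
rewrite real_normK ?num_real// sqr_triple// sqr_enorm !dot_cross_cross -!sqr_enorm.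
by rewrite u1 v1 w1 [dot v u]dotC [dot v w]dotC [dot u w]dotC; apply/eqP; ring.
Qed.

End Vectors.

(** * Weights of a triangular face seen from the origin *)

Section FaceMu.
Set Implicit Arguments.
Unset Strict Implicit.
Unset Printing Implicit Defensive.
Variable R : realType.
Implicit Types a b c x : 'rV[R]_3.

Definition edge_normal a b := normalize (cross a b).

(** The weight mu of the vertex a in the face [a, b, c], for the point 0 and unit
vectors, as a function of the vectors rather than of vertex labels. *)
Definition face_mu a b c : R :=
  (vangle b c + vangle a b * dot (edge_normal a b) (edge_normal b c)
              + vangle c a * dot (edge_normal c a) (edge_normal b c))
  / (2 * dot a (edge_normal b c)).

Lemma edge_normalC a b : edge_normal a b = - edge_normal b a.
Proof. by rewrite /edge_normal crossC normalizeN. Qed.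

Lemma dot_edge_normal a b c d : dot (edge_normal a b) (edge_normal c d) =
  dot (cross a b) (cross c d) / (enorm (cross a b) * enorm (cross c d)).
Proof. by rewrite /edge_normal /normalize dotZl dotZr mulrA -invfM mulrC. Qed.

Lemma face_mu_swap a b c : face_mu a c b = - face_mu a b c.
Proof.
rewrite /face_mu (edge_normalC a c) (edge_normalC c b) (edge_normalC b a).
rewrite !(dotNl, dotNr) !opprK mulrN invrN mulrN; congr (- (_ / _)).
by rewrite (vangleC c b) (vangleC a c) (vangleC b a); ring.
Qed.

(** The cosines of the dihedral angles of the cone over [a, b, c] in terms of the
cosines of its face angles. *)
Lemma face_muE a b c : enorm a = 1 -> enorm b = 1 -> enorm c = 1 ->
  face_mu a b c =
  (vangle b c
   - vangle a b * ((dot c a - dot a b * dot b c)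
                   / (enorm (cross a b) * enorm (cross b c)))
   - vangle c a * ((dot a b - dot b c * dot c a)
                   / (enorm (cross c a) * enorm (cross b c))))
  * (enorm (cross b c) / (2 * dot a (cross b c))).
Proof.
move=> a1 b1 c1; rewrite /face_mu !dot_edge_normal !dot_cross_cross.
have -> : dot b b = 1 by rewrite -sqr_enorm b1 expr1n.
have -> : dot c c = 1 by rewrite -sqr_enorm c1 expr1n.
rewrite /edge_normal /normalize dotZr [dot a c]dotC [dot c b]dotC.
have denE (s d : R) : (2 * (s^-1 * d))^-1 = s / (2 * d).
  by rewrite mulrCA invfM invrK.
rewrite denE !mul1r !mulr1.
by congr (_ * _); ring.
Qed.

Lemma unit_vangle a b : enorm a = 1 -> enorm b = 1 -> 0 < enorm (cross a b) ->
  [/\ cos (vangle a b) = dot a b, sin (vangle a b) = enorm (cross a b)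
    & 0 < vangle a b < pi].
Proof.
move=> a1 b1 s0.
have c_ : cos (vangle a b) = dot a b by rewrite cos_vangle ?a1 ?b1// mulr1 divr1.
have s_ : sin (vangle a b) = enorm (cross a b).
  by rewrite sin_vangle ?a1 ?b1// mulr1 divr1.
split=> //.
have I : -1 <= dot a b / (enorm a * enorm b) <= 1 by rewrite vangle_itv ?a1 ?b1.
have h0 := acos_ge0 I; have hpi := acos_lepi I.
rewrite !lt_neqAle h0 hpi !andbT; apply/andP; split.
  by apply/eqP => e; move: s0; rewrite -s_ -e sin0 ltxx.
by apply/eqP => e; move: s0; rewrite -s_ e sinpi ltxx.
Qed.

(** Cauchy-Schwarz for the two edge normals at b: the spherical law of cosines does
define the cosine of an angle. *)
Lemma unit_vertex_angle a b c : enorm b = 1 ->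
  `|dot c a - dot a b * dot b c| <= enorm (cross a b) * enorm (cross b c).
Proof.
move=> b1; have := cauchy_schwarz (cross a b) (cross b c).
rewrite dot_cross_cross; have -> : dot b b = 1 by rewrite -sqr_enorm b1 expr1n.
by rewrite mulr1 [dot a c]dotC -normrN opprB.
Qed.

(** The numerator of mu_a is the length of the side opposite to a minus the
projections of the two other sides onto it. *)
Lemma face_mu_ge0 a b c : enorm a = 1 -> enorm b = 1 -> enorm c = 1 ->
  0 < dot a (cross b c) -> 0 <= face_mu a b c.
Proof.
move=> a1 b1 c1 D0; rewrite face_muE//.
have sbc : 0 < enorm (cross b c) by apply: (@enorm_cross_gt0 _ a); rewrite gt_eqF.
have sca : 0 < enorm (cross c a).
  by apply: (@enorm_cross_gt0 _ b); rewrite -triple_rot gt_eqF.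
have sab : 0 < enorm (cross a b).
  by apply: (@enorm_cross_gt0 _ c); rewrite triple_rot gt_eqF.
rewrite mulr_ge0 ?divr_ge0 ?mulr_ge0 ?(ltW D0) ?(ltW sbc)//.
have [cAB sAB iAB] := unit_vangle a1 b1 sab.
have [cBC sBC iBC] := unit_vangle b1 c1 sbc.
have [cCA sCA iCA] := unit_vangle c1 a1 sca.
have := @spherical_projection_le R _ _ _ iCA iAB iBC.
rewrite cAB cBC cCA sAB sBC sCA unit_vertex_angle// => /(_ isT).
have := unit_vertex_angle b a c1.
rewrite [enorm (cross b c) * _]mulrC [dot b c * _]mulrC => -> /(_ isT).
lra.
Qed.

(** Replacing x by - x turns its angle with a into the supplement and reverses the
signs of the other terms, so only the contributions of pi remain. They give
pi (1 - cos alpha) sin theta_b / (2 D), where the triple product D of a, b, x equals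
sin alpha sin theta_a sin theta_b. *)
Lemma face_mu_pair a b x : enorm a = 1 -> enorm b = 1 -> enorm x = 1 ->
  0 < dot a (cross b x) ->
  face_mu a b x + face_mu a (- x) b =
  pi / 2 * (tan (vangle (cross x a) (cross x b) / 2) / sin (vangle x a)).
Proof.
move=> a1 b1 x1 D0.
have sbx : 0 < enorm (cross b x) by apply: (@enorm_cross_gt0 _ a); rewrite gt_eqF.
have sxa : 0 < enorm (cross x a).
  by apply: (@enorm_cross_gt0 _ b); rewrite -triple_rot gt_eqF.
have sab : 0 < enorm (cross a b).
  by apply: (@enorm_cross_gt0 _ x); rewrite triple_rot gt_eqF.
have sxb : 0 < enorm (cross x b) by rewrite enorm_crossC.
have [_ sinxa _] := unit_vangle x1 a1 sxa.
have sinal : sin (vangle (cross x a) (cross x b)) =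
    dot a (cross b x) / (enorm (cross x a) * enorm (cross x b)).
  by rewrite sin_vangle// enorm_cross_cross// gtr0_norm.
rewrite tan_half; last by rewrite sinal gt_eqF// divr_gt0// mulr_gt0.
rewrite sinal sinxa cos_vangle// (face_mu_swap a b (- x)) !face_muE ?enormN//.
rewrite !(crossNl, crossNr, dotNl, dotNr, enormN).
rewrite vangleNr ?b1 ?x1// vangleNl ?a1 ?x1// dot_cross_cross.
rewrite [enorm (cross x b)]enorm_crossC [dot x b]dotC [dot a x]dotC.
rewrite [dot x x](_ : _ = 1) ?mul1r; last by rewrite -sqr_enorm x1 expr1n.
set B := vangle b x; set A := vangle x a; set C := vangle a b.
by field; rewrite !gt_eqF.
Qed.

(** The component along x of the relation
mu_x x + mu_a a + mu_b b = (sum of beta n) / 2: the normals of the two edges at x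
are orthogonal to x. *)
Lemma face_precision a b x : enorm a = 1 -> enorm b = 1 -> enorm x = 1 ->
  0 < dot a (cross b x) ->
  face_mu x a b + dot x a * face_mu a b x + dot x b * face_mu b x a =
  vangle a b * dot a (cross b x) / (2 * enorm (cross a b)).
Proof.
move=> a1 b1 x1 D0.
have sbx : 0 < enorm (cross b x) by apply: (@enorm_cross_gt0 _ a); rewrite gt_eqF.
have sxa : 0 < enorm (cross x a).
  by apply: (@enorm_cross_gt0 _ b); rewrite -triple_rot gt_eqF.
have sab : 0 < enorm (cross a b).
  by apply: (@enorm_cross_gt0 _ x); rewrite triple_rot gt_eqF.
have gram := sqr_triple a1 b1 x1.
have gab := sqr_enorm_cross a1 b1.
have gbx := sqr_enorm_cross b1 x1.
have gxa := sqr_enorm_cross x1 a1.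
rewrite !face_muE// (triple_rot x a b) -(triple_rot a b x) [dot x b]dotC.
set C := vangle a b; set B := vangle b x; set A := vangle x a.
set D := dot a (cross b x) in D0 gram *.
set p := dot a b in gram gab *; set q := dot b x in gram gbx *.
set r := dot x a in gram gxa *.
move: (enorm (cross a b)) (enorm (cross b x)) (enorm (cross x a)) sab sbx sxa gab gbx gxa.
move=> sc sb sa sc0 sb0 sa0 gab gbx gxa.
(* Grouped by angles: the coefficient of C is the Gram determinant, and those of
   A and B vanish by Pythagoras. *)
transitivity ((C * (sc ^+ 2 - r ^+ 2 - q ^+ 2 + 2 * (p * q * r)) / sc
  + A * q * (sa ^+ 2 - 1 + r ^+ 2) / sa
  + B * r * (sb ^+ 2 - 1 + q ^+ 2) / sb) / (2 * D)).
  by field; rewrite !gt_eqF.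
have -> : sc ^+ 2 - r ^+ 2 - q ^+ 2 + 2 * (p * q * r) = D ^+ 2.
  by rewrite gram gab; ring.
rewrite gxa gbx.
by field; rewrite !gt_eqF.
Qed.

End FaceMu.

(** * The two faces of the bipyramid over an equatorial edge *)

Section FacePairs.
Set Implicit Arguments.
Unset Strict Implicit.
Unset Printing Implicit Defensive.
Variable R : realType.
Implicit Types a b c x : 'rV[R]_3.

(** [face_mu_pair] with x and - x exchanged, which restores the
orientation when the edge ends at a instead of starting there. *)
Lemma face_mu_pair_pred a c x : enorm a = 1 -> enorm c = 1 -> enorm x = 1 ->
  0 < dot c (cross a x) ->
  face_mu a x c + face_mu a c (- x) =
  pi / 2 * (tan (vangle (cross x c) (cross x a) / 2) / sin (vangle x a)).
Proof.
move=> a1 c1 x1 D0; rewrite addrC -{2}(opprK x) face_mu_pair ?enormN//; last first.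
  by rewrite crossNr dotNr crossC dotNr opprK -triple_rot.
have -> : vangle (cross (- x) a) (cross (- x) c) = vangle (cross x c) (cross x a).
  by rewrite vangleC !crossNl /vangle !enormN dotNl dotNr opprK.
by rewrite vangleNl ?a1 ?x1// sinB sinpi cospi; congr (_ * (_ / _)); ring.
Qed.

Lemma tan_half_dihedral_gt0 a b x : enorm a = 1 -> enorm b = 1 -> enorm x = 1 ->
  0 < dot a (cross b x) ->
  0 < tan (vangle (cross x a) (cross x b) / 2).
Proof.
move=> a1 b1 x1 D0.
have sxb : 0 < enorm (cross x b).
  by rewrite enorm_crossC; apply: (@enorm_cross_gt0 _ a); rewrite gt_eqF.
have sxa : 0 < enorm (cross x a).
  by apply: (@enorm_cross_gt0 _ b); rewrite -triple_rot gt_eqF.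
have sin0 : 0 < sin (vangle (cross x a) (cross x b)).
  rewrite sin_vangle// enorm_cross_cross//.
  by rewrite gtr0_norm// divr_gt0// mulr_gt0.
rewrite tan_half ?gt_eqF// divr_gt0// subr_gt0 lt_neqAle cos_le1 andbT.
apply: contraTneq sin0 => c1.
by have /eqP := sin2cos2 (vangle (cross x a) (cross x b));
  rewrite c1 expr1n subrr sqrf_eq0 => /eqP ->; rewrite ltxx.
Qed.

(** [face_precision] for the faces [x, a, b] and [-x, b, a] has the same right-hand
side, so the difference of the apex weights is carried by the paired weights at
a and b, each times the cosine of its angle with x. *)
Lemma face_mu_apex_diff a b x : enorm a = 1 -> enorm b = 1 -> enorm x = 1 ->
  0 < dot a (cross b x) ->
  face_mu (- x) b a - face_mu x a b =
  pi / 2 * tan (vangle (cross x a) (cross x b) / 2)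
  * (cot (vangle x a) + cot (vangle x b)).
Proof.
move=> a1 b1 x1 D0.
have eD : dot b (cross a (- x)) = dot a (cross b x).
  by rewrite crossNr dotNr crossC dotNr opprK -triple_rot.
have D0' : 0 < dot b (cross a (- x)) by rewrite eD.
have pre := face_precision a1 b1 x1 D0.
have xN1 : enorm (- x) = 1 by rewrite enormN.
have pre' := face_precision b1 a1 xN1 D0'.
move: pre'; rewrite eD vangleC enorm_crossC -pre !dotNl.
move=> precision_south.
have pa := face_mu_pair a1 b1 x1 D0.
have pb := face_mu_pair_pred b1 a1 x1 D0.
have cotE c : enorm c = 1 -> cot (vangle x c) = dot x c / sin (vangle x c).
  by move=> c1; rewrite /cot cos_vangle ?x1 ?c1// mulr1 divr1.
rewrite !cotE//.
set T := tan _ in pa pb *.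
transitivity (dot x a * (face_mu a b x + face_mu a (- x) b)
  + dot x b * (face_mu b x a + face_mu b a (- x))); first by lra.
by rewrite pa pb; ring.
Qed.

End FacePairs.

(** * Weights of the bipyramid *)

Section Bipyramid.
Set Implicit Arguments.
Unset Strict Implicit.
Unset Printing Implicit Defensive.
Variables (R : realType) (n : nat) (v : 'I_n -> 'rV[R]_3) (x : 'rV[R]_3).
Hypothesis v1 : forall i, enorm (v i) = 1.
Hypothesis x1 : enorm x = 1.
Hypothesis ker : forall i, 0 < dot (v i) (cross (v (ordS i)) x).

Local Notation w := (bipyramid_vertex v x).
Local Notation F := (bipyramid_faces n).
Local Notation omega := (mv_omega w F 0).
Local Notation t i := (tan (alpha v x i / 2)).

Lemma bipyramid_vertex1 r : enorm (w r) = 1.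
Proof. by case: r => [i|[]] //=; rewrite enormN. Qed.

Lemma bipyramid_muE r s u : mv_mu w 0 r s u = face_mu (w r) (w s) (w u).
Proof.
by rewrite /mv_mu /mv_beta /mv_n /mv_e !subr0 !(normalize_unit (bipyramid_vertex1 _)).
Qed.

Lemma bipyramid_facesP a b c : (a, b, c) \in F =
  match a, b, c with
  | inr true, inl i, inl j => j == ordS i
  | inr false, inl i, inl j => i == ordS j
  | _, _, _ => false
  end.
Proof.
rewrite mem_cat; apply/orP/idP => [[]/mapP[i _ [-> -> ->]] //|].
case: a b c => [//|[]] [i|//] [j|//] /eqP ->; [left|right];
  by apply/mapP; eexists; first exact: mem_enum.
Qed.

Lemma sum_oriented_face r (s : seq (('I_n + bool) * ('I_n + bool)))
    (f : ('I_n + bool) * ('I_n + bool) -> R) :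
  uniq s -> (forall p, oriented_face F r p.1 p.2 = (p \in s)) ->
  \sum_(p | oriented_face F r p.1 p.2) f p = \sum_(p <- s) f p.
Proof. by move=> us sP; rewrite big_uniq//; apply: eq_bigl. Qed.

Lemma omega_equator i :
  omega (inl i) = pi / 2 * ((t i + t (ord_pred i)) / sin (theta v x i)).
Proof.
rewrite /mv_omega subr0 bipyramid_vertex1 invr1 mul1r.
(* the faces over [v_i, v_(i+1)] and over [v_(i-1), v_i], at x and at - x *)
rewrite (@sum_oriented_face _ [:: (inl (ordS i), inr true);
  (inr false, inl (ordS i)); (inr true, inl (ord_pred i));
  (inl (ord_pred i), inr false)]); first last.
- have ordS_eq k : (i == ordS k) = (k == ord_pred i).
    by rewrite eq_sym (can2_eq (@ordSK n) (@ord_predK n)).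
  by case=> [[j|[]] [k|[]]]; rewrite /oriented_face !bipyramid_facesP !inE
    !xpair_eqE ?sum_eqE /= ?andbT ?andbF ?orbF.
- by rewrite /= !inE !xpair_eqE !andbF.
rewrite !big_cons big_nil addr0 !bipyramid_muE /=.
rewrite addrA face_mu_pair// face_mu_pair_pred//; last first.
  by have := ker (ord_pred i); rewrite ord_predK.
by rewrite /alpha /theta ord_predK; ring.
Qed.

Lemma omega_north :
  omega (inr true) = \sum_i face_mu x (v i) (v (ordS i)).
Proof.
rewrite /mv_omega subr0 bipyramid_vertex1 invr1 mul1r.
rewrite (@sum_oriented_face _ [seq (inl i, inl (ordS i)) | i <- enum 'I_n]).
- by rewrite big_map big_enum/=; apply: eq_bigr => i _; rewrite bipyramid_muE.
- by rewrite map_inj_uniq ?enum_uniq// => i j [].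
case=> [[j|[]] [k|[]]]; rewrite /oriented_face !bipyramid_facesP //= ?orbF;
  apply/idP/mapP => [//|[i _ //]].
  by move=> /eqP ->; eexists; first exact: mem_enum.
by move=> [-> ->].
Qed.

Lemma omega_south :
  omega (inr false) = \sum_i face_mu (- x) (v (ordS i)) (v i).
Proof.
rewrite /mv_omega subr0 bipyramid_vertex1 invr1 mul1r.
rewrite (@sum_oriented_face _ [seq (inl (ordS i), inl i) | i <- enum 'I_n]).
- by rewrite big_map big_enum/=; apply: eq_bigr => i _; rewrite bipyramid_muE.
- by rewrite map_inj_uniq ?enum_uniq// => i j [].
case=> [[j|[]] [k|[]]]; rewrite /oriented_face !bipyramid_facesP //= ?orbF;
  apply/idP/mapP => [//|[i _ //]].
  by move=> /eqP ->; eexists; first exact: mem_enum.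
by move=> [-> ->].
Qed.

(** Each vertex v_j receives a contribution from the edges [v_j, v_(j+1)] and
[v_(j-1), v_j]; the sum over edges is reindexed accordingly. *)
Lemma omega_apex_diff :
  omega (inr false) - omega (inr true) =
  pi / 2 * \sum_j cot (theta v x j) * (t j + t (ord_pred j)).
Proof.
rewrite omega_north omega_south -sumrB.
under eq_bigr do rewrite face_mu_apex_diff// -mulrA mulrDr.
rewrite -mulr_sumr big_split/=; congr (_ * _).
under [RHS]eq_bigr do rewrite mulrDr.
rewrite big_split/=; congr (_ + _); first by apply: eq_bigr => j _; rewrite mulrC.
rewrite [RHS](reindex (@ordS n)) /=; last exact/onW_bij/ordS_bij.
by apply: eq_bigr => j _; rewrite ordSK mulrC.
Qed.

(** The total weight is the common denominator of all phi, which cancels in psi. It is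
the equatorial vertices that make it positive, hence i0. *)
Lemma sum_omega_gt0 (i0 : 'I_n) : 0 < \sum_r omega r.
Proof.
have equator_gt0 i : 0 < omega (inl i).
  rewrite omega_equator mulr_gt0 ?divr_gt0 ?pi_gt0//.
    by rewrite addr_gt0// /alpha tan_half_dihedral_gt0//.
  rewrite /theta sin_vangle ?v1 ?x1// mulr1 divr1.
  by apply: (@enorm_cross_gt0 _ (v (ordS i))); rewrite -triple_rot gt_eqF.
have north : 0 <= omega (inr true).
  rewrite omega_north sumr_ge0// => i _; rewrite face_mu_ge0//.
  by rewrite triple_rot ker.
have south : 0 <= omega (inr false).
  rewrite omega_south sumr_ge0// => i _; rewrite face_mu_ge0 ?enormN//.
  by rewrite dotNl crossC dotNr opprK triple_rot ker.
rewrite big_sumType/= big_bool/= ltr_wpDr ?addr_ge0//.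
by rewrite (bigD1 i0)//= ltr_wpDr// sumr_ge0// => i _; exact/ltW.
Qed.

Lemma psi_lambda i : psi v x i = smv_lambda v x i.
Proof.
rewrite /psi /bipyramid_phi /mv_phi -mulrBl invfM invrK mulrACA -[_ / _ * _]mulrA.
have S0 := sum_omega_gt0 i.
rewrite mulVf ?gt_eqF// mulr1 omega_apex_diff omega_equator /smv_lambda.
have p0 : pi / 2 != 0 :> R by rewrite gt_eqF// divr_gt0 ?pi_gt0.
by rewrite -mulf_div divff// mul1r [_ / sin _]mulrC.
Qed.

End Bipyramid.

(** * Spherical mean value coordinates *)

Theorem mainTheorem2 (R : realType) (n : nat) (v : 'I_n -> 'rV[R]_3)
    (P : set 'rV[R]_3) (x : 'rV[R]_3)
    (hP : spherical_polygon v P)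
    (hhemi : in_common_hemisphere P)
    (hacw : anticlockwise v P)
    (hx : poly_interior v P x)
    (hxv : forall i : 'I_n, 0 < dot x (v i))
    (hker : forall i : 'I_n, 0 < dot (v i) (cross (v (ordS i)) x)) :
  forall i : 'I_n,
    psi v x i = smv_lambda v x i /\
    smv_lambda v x i =
      ((sin (theta v x i))^-1
         * (tan (alpha v x i / 2) + tan (alpha v x (ord_pred i) / 2)))
      / \sum_(j < n) (cot (theta v x j)
           * (tan (alpha v x j / 2) + tan (alpha v x (ord_pred j) / 2))).
Proof.
move=> i; split=> //; apply: psi_lambda => //.
- by case: hP => -[].
- move: hP hx => [_ [y _ ->]] [[//|xC] _].
  by have /(_ x xC)[] := @connected_component_sub _ (@usphere R `\` poly_boundary v) y.
Qed.
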